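(* There exist countably infinite semiprimitive integral domains $R$ and $S$, neither of which is a field, such that the Macías spaces $M(R)$ and $M(S)$ are not homeomorphic.
   Context: For a commutative integral domain $R$ with $1 \neq 0$, write $R^0 = R \setminus \{0\}$. For $k \in R^0$ let $\sigma_k^0 := \{s \in R^0 : \langle k \rangle + \langle s \rangle = R\}$, where $\langle k \rangle$ is the principal ideal generated by $k$. The sets $\sigma_k^0$ ($k \in R^0$) form a basis of a topology on $R^0$; the Macías space $M(R)$ is the set $R^0$ with this topology. The Jacobson radical $\mathfrak{J}(R)$ is the intersection of all maximal ideals of $R$, and $R$ is semiprimitive if $\mathfrak{J}(R) = \{0\}$. *)

(* Defs.v *)
From HB Require Import structures.
From mathcomp Require Import all_boot all_order all_algebra.
From mathcomp Require Import ring_quotient.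
From mathcomp Require Import all_classical topology.

Set Implicit Arguments.
Unset Strict Implicit.
Unset Printing Implicit Defensive.

Import GRing.Theory.

Local Open Scope classical_set_scope.
Local Open Scope ring_scope.

Definition principal_ideal (R : idomainType) (k : R) : set R :=
  [set a * k | a in [set: R]].

Definition ideal_sum (R : idomainType) (I J : set R) : set R :=
  [set x + y | x in I & y in J].

(* [idealr_closed] already requires the ideal to be proper (1 \notin I);
   it is applied to the boolean membership predicate of the set I. *)
Definition maximal_ideal (R : idomainType) (I : set R) : Prop :=
  idealr_closed [in I] /\
  forall J : set R, idealr_closed [in J] -> I `<=` J -> J = I.

Definition jacobson_radical (R : idomainType) : set R :=
  \bigcap_(I in @maximal_ideal R) I.

Definition semiprimitive (R : idomainType) : Prop :=
  @jacobson_radical R = [set 0].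

Definition macias (R : idomainType) : Type := {x : R | x != 0}.

HB.instance Definition _ (R : idomainType) := Choice.on (macias R).
HB.instance Definition _ (R : idomainType) :=
  isPointed.Build (macias R) (exist _ 1 (oner_neq0 R)).

(* sigma_k^0 *)
Definition macias_basic (R : idomainType) (k : macias R) : set (macias R) :=
  [set s | ideal_sum (principal_ideal (val k)) (principal_ideal (val s))
           = [set: R]].

Section MaciasTopology.
Variable R : idomainType.
Implicit Types k l s : macias R.

Let macias_basicP k s :
  macias_basic k s <-> exists a b, a * val k + b * val s = 1.
Proof.
split=> [ks|[a [b ab1]]].
  have : [set: R] 1 by [].
  by rewrite -ks => -[_ [a _ <-] [_ [b _ <-] ab]]; exists a, b.
apply/seteqP; split=> // x _; exists (x * a * val k); first by exists (x * a).
exists (x * b * val s); first by exists (x * b).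
by rewrite -!mulrA -mulrDr ab1 mulr1.
Qed.

Let macias_cover : \bigcup_(k in [set: macias R]) macias_basic k = setT.
Proof.
apply/seteqP; split=> // s _; exists point => //.
by apply/macias_basicP; exists 1, 0; rewrite mul0r addr0 mulr1.
Qed.

Let macias_join k l s : [set: macias R] k -> [set: macias R] l ->
  macias_basic k s -> macias_basic l s ->
  exists m, [/\ [set: macias R] m, macias_basic m s
    & macias_basic m `<=` macias_basic k `&` macias_basic l].
Proof.
move=> _ _ /macias_basicP[a [b ab]] /macias_basicP[c [d cd]].
exists (exist _ (val k * val l) (mulf_neq0 (valP k) (valP l))); split=> //.
  apply/macias_basicP; exists (a * c), (a * val k * d + b) => /=.
  rewrite mulrDl addrA mulrACA -(mulrA (a * val k)) -mulrDr cd mulr1.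
  exact: ab.
move=> t /macias_basicP[u [v uv]]; split; apply/macias_basicP.
  by exists (u * val l), v; rewrite -mulrA (mulrC (val l)).
by exists (u * val k), v; rewrite -mulrA.
Qed.

HB.instance Definition _ :=
  isBaseTopological.Build (macias R) macias_cover macias_join.

Lemma open_maciasE (A : set (macias R)) :
  open A <-> exists D : set (macias R), A = \bigcup_(k in D) macias_basic k.
Proof. by split=> [[D _ <-]|[D ->]]; exists D. Qed.

End MaciasTopology.

Definition homeomorphic (X Y : topologicalType) : Prop :=
  exists (f : X -> Y) (g : Y -> X),
    [/\ cancel f g, cancel g f, continuous f & continuous g].

(* Main.v *)
Require Import Defs.
From HB Require Import structures.
From mathcomp Require Import all_boot all_order all_algebra.
From mathcomp Require Import all_classical topology.

(** A point of [M(R)] is dense exactly when it is a unit of [R], so the number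
    of units is a topological invariant of the Macias space. Hence [M(Z)], with
    two dense points, is not homeomorphic to [M(Q[X])], with infinitely many. *)

Local Open Scope classical_set_scope.
Local Open Scope card_scope.

Set Implicit Arguments.
Unset Strict Implicit.

Import GRing.Theory Num.Theory.

Local Open Scope ring_scope.

(** If [J] contains the kernel and some [x] with [f x != 0], choose [y] mapping to the inverse of
    [f x]: then [1 = y * x + (1 - y * x)] lies in [J], which is impossible. *)
Lemma maximal_ideal_ker (R : idomainType) (F : fieldType)
    (f : {rmorphism R -> F}) :
  (forall y, exists x, f x = y) -> maximal_ideal [set x | f x = 0].
Proof.
move=> f_surj; split.
  split; rewrite ?inE /= ?rmorph0 //.
    by apply/negP; rewrite inE /= rmorph1; apply/eqP/oner_neq0.
  move=> a x y; rewrite !inE /= rmorphD rmorphM => -> ->.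
  by rewrite mulr0 addr0.
move=> J [_ J1 JD] kerJ; apply/seteqP; split=> // x Jx /=.
have [// | fx0] := eqVneq (f x) 0.
have [y fy] := f_surj (f x)^-1.
case/negP: J1; rewrite -(subrKC (y * x) 1) JD ?inE //.
by apply: kerJ; rewrite /= rmorphB rmorphM rmorph1 fy mulVf ?subrr.
Qed.

(** Each nonzero [a] escapes the maximal ideal that is the kernel of a suitable surjection onto a
    field. *)
Lemma semiprimitive_rmorph (R : idomainType) :
  (forall a : R, a != 0 -> exists (F : fieldType) (f : {rmorphism R -> F}),
     (forall y, exists x, f x = y) /\ f a != 0) ->
  semiprimitive R.
Proof.
move=> sepR; apply/seteqP; split=> [a Ja | _ -> I [[I0 _ _] _]]; last first.
  by rewrite inE in I0.
apply/eqP; apply: contraT => /sepR[F [f [f_surj]]].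
by rewrite (Ja _ (maximal_ideal_ker f_surj)) eqxx.
Qed.

Lemma semiprimitive_int : semiprimitive int.
Proof.
apply: semiprimitive_rmorph => a a0.
(* A prime larger than the absolute value of [a] cannot divide [a], so [a] survives reduction mod
   [p]. *)
have [p a_lt_p p_pr] := prime_above `|a|%N.
exists 'F_p, (GRing.RMorphism.clone _ _ ( *~%R 1) _); split=> [y | ].
  by exists (val y)%:Z; rewrite /= -pmulrn natr_Zp.
rewrite /= (intEsign a) rmorphM rmorph_sign mulf_neq0 ?signr_eq0 //.
by rewrite /= -pmulrn -(dvdn_pcharf (pchar_Fp p_pr)) gtnNdvd ?absz_gt0.
Qed.

Lemma semiprimitive_poly (F : numFieldType) : semiprimitive {poly F}.
Proof.
apply: semiprimitive_rmorph => p p0.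
have [x px] : exists x, ~~ root p x.
  (* Otherwise the naturals below [size p], distinct in characteristic 0, would be [size p] roots of
     a nonzero polynomial of smaller degree. *)
  apply: contrapT => /forallNP rootp.
  pose rs := [seq n%:R : F | n <- iota 0 (size p)].
  suff: (size rs < size p)%N by rewrite size_map size_iota ltnn.
  apply: max_poly_roots => //; first by apply/allP => x _; apply/negPn/negP.
  by rewrite map_inj_uniq ?iota_uniq // => m n /eqP; rewrite eqr_nat => /eqP.
exists F, (GRing.RMorphism.clone _ _ (horner_eval x) _);
  split=> // y; exists y%:P.
by rewrite /= /horner_eval hornerC.
Qed.

(** The basic set of [s] contains 1, so a dense [s] meets it and is comaximal with itself.
    Conversely, a unit is comaximal with everything, so it lies in every basic set. *)
Lemma dense_macias1P (R : idomainType) (s : macias R) :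
  dense [set s] <-> val s \is a GRing.unit.
Proof.
split=> [s_dense | s_unit O [t Ot] /open_maciasE[D DO]].
  have [] := s_dense (macias_basic s).
  - exists (exist _ 1 (oner_neq0 R)); apply/seteqP; split=> // x _.
    exists 0; first by exists 0; rewrite ?mul0r.
    by exists x; rewrite ?add0r //; exists x; rewrite ?mulr1.
  - by apply/open_maciasE; exists [set s]; rewrite bigcup_set1.
  move=> t [+ ts]; rewrite {}ts => s_comax.
  have : [set: R] 1 by [].
  rewrite -s_comax => -[_ [a _ <-] [_ [b _ <-]]]; rewrite -mulrDl => ab.
  by apply/unitrPr; exists (a + b); rewrite mulrC.
exists s; split=> //; move: Ot; rewrite DO => -[k Dk _].
exists k => //; apply/seteqP; split=> // x _.
exists 0; first by exists 0; rewrite ?mul0r.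
by exists x; rewrite ?add0r //; exists (x / val s); rewrite ?divrK.
Qed.

(** The right inverse [g] makes the preimage of a nonempty open set nonempty, so that preimage
    contains [x]. *)
Lemma dense_image_cancel (X Y : topologicalType) (f : X -> Y) (g : Y -> X) :
  cancel g f -> continuous f ->
  forall x, dense [set x] -> dense [set f x].
Proof.
move=> gK /continuousP f_cont x x_dense O [y Oy] /f_cont Of.
have [] := x_dense (f @^-1` O) _ Of; first by exists (g y); rewrite /= gK.
by move=> t [+ ts]; rewrite ts; exists (f x).
Qed.

Lemma card_eq_nat_inj (R : countType) (f : nat -> R) :
  injective f -> ([set: R] #= [set: nat])%card.
Proof.
move=> f_inj; apply: eq_card_nat; first exact: countableP.
move=> /(finite_preimage (f := f)) finf; apply: infinite_nat.
by rewrite -(preimage_setT f); apply: finf => x y _ _ /f_inj.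
Qed.

Lemma macias_int_ratX_nhomeo : ~ homeomorphic (macias int) (macias {poly rat}).
Proof.
move=> [f [g [fK gK _ g_cont]]].
have nz (n : nat) : n.+1%:R != 0 :> {poly rat}.
  by rewrite -polyC_natr polyC_eq0 pnatr_eq0.
(* Infinitely many units of the polynomial ring: the nonzero constants 1, 2, 3, and so on. *)
pose u n : macias {poly rat} := exist _ n.+1%:R (nz n).
have u_inj : injective u.
  move=> m n /(congr1 val)/= /eqP.
  by rewrite -!polyC_natr (inj_eq polyC_inj) eqr_nat => /eqP[].
pose v n := val (g (u n)).
have v_inj : injective v by move=> m n /val_inj/(can_inj gK)/u_inj.
have v_unit n : v n \in [:: 1; -1].
  have : v n \is a GRing.unit.
    apply/dense_macias1P/(dense_image_cancel fK g_cont).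
    by apply/dense_macias1P; rewrite /= -polyC_natr poly_unitE size_polyC
      coefC /= unitfE pnatr_eq0.
  by rewrite !inE; exact.
(* Pigeonhole: three distinct values cannot fit among the two units of [int]. *)
have : (size [seq v n | n <- iota 0 3] <= size ([:: 1; -1] : seq int)%R)%N.
  apply: uniq_leq_size; first by rewrite map_inj_uniq.
  by move=> _ /mapP[n _ ->].
by [].
Qed.

Theorem corollary4p3 :
  exists R S : idomainType,
    [/\ [set: R] #= [set: nat], semiprimitive R & ~ GRing.field_axiom R] /\
    [/\ [set: S] #= [set: nat], semiprimitive S & ~ GRing.field_axiom S] /\
    ~ homeomorphic (macias R) (macias S).
Proof.
exists int, {poly rat}; split; [split | split; [split | ]].
- by apply: (@card_eq_nat_inj _ Posz) => m n [].
- exact: semiprimitive_int.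
- by move=> /(_ 2 isT).
- apply: (@card_eq_nat_inj _ (fun n => 'X^n)) => m n /(congr1 (size \o val)).
  by rewrite /= !size_polyXn => -[].
- exact: semiprimitive_poly.
(* A unit polynomial has size 1, whereas ['X] has size 2. *)
- by move=> /(_ 'X); rewrite polyX_eq0 poly_unitE size_polyX => /(_ isT).
- exact: macias_int_ratX_nhomeo.
Qed.
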